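(* Consider the energy sharing game with $N\ge 2$ prosumers, price sensitivity $a<0$, and parameters $c_i>0$, $d_i>0$, $D_i\in\mathbb{R}$ ($i\in\mathcal{I}=\{1,\dots,N\}$), as defined in the context. There exists a unique Nash equilibrium of the sharing game. Moreover, a strategy profile $(p^*,b^* )\in\mathbb{R}^N\times\mathbb{R}^N$ is the unique Nash equilibrium if and only if $p^*=(p_i^* )_{i\in\mathcal{I}}$ is the unique optimal solution of $$\min_{p\in\mathbb{R}^N}\ \sum_{i=1}^N\left[\left(c_i-\frac{1}{2(N-1)a}\right)p_i^2+\left(d_i+\frac{D_i}{(N-1)a}\right)p_i\right]\quad\text{s.t.}\quad \sum_{i=1}^N p_i=\sum_{i=1}^N D_i,$$ and $b_i^*=\tilde b_i(p^* )$ for all $i\in\mathcal{I}$, where $\tilde\lambda(p):=\frac1N\sum_{j=1}^N(2c_jp_j+d_j)$ and $\tilde b_i(p):=D_i-p_i-a\tilde\lambda(p)$.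
   Context: Energy sharing game. The players (prosumers) are $\mathcal{I}=\{1,\dots,N\}$. Prosumer $i$ has a required load reduction $D_i\in\mathbb{R}$ and disutility function $f_i(p_i)=c_ip_i^2+d_ip_i$ with $c_i,d_i>0$. The common price sensitivity is $a<0$. Each prosumer $i$ chooses an output adjustment $p_i\in\mathbb{R}$ and a bid $b_i\in\mathbb{R}$. Given the bids $b=(b_1,\dots,b_N)$, the sharing price is $\lambda_c(b)=-\frac{1}{Na}\sum_{j=1}^N b_j$ (equivalently, the market clears: $\sum_i(a\lambda_c+b_i)=0$), and prosumer $i$ buys the quantity $q_i(b)=a\lambda_c(b)+b_i$ (sells if negative). Given the other bids $b_{-i}$, prosumer $i$ minimizes $$\Pi_i(p_i,b_i,b_{-i})=c_ip_i^2+d_ip_i+(a\lambda_c(b)+b_i)\lambda_c(b)$$ over the action set $X_i(b_{-i})=\{(p_i,b_i)\in\mathbb{R}^2:\ p_i+a\lambda_c(b)+b_i=D_i\}$. A profile $(p^*,b^* )$ is a Nash equilibrium if for every $i$, $(p_i^*,b_i^* )\in X_i(b_{-i}^* )$ and $\Pi_i(p_i^*,b_i^*,b_{-i}^* )\le\Pi_i(p_i,b_i,b_{-i}^* )$ for all $(p_i,b_i)\in X_i(b_{-i}^* )$. *)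

(* Defs.v *)
From mathcomp Require Import all_boot all_order all_algebra.
From mathcomp Require Import reals.

Set Implicit Arguments.
Unset Strict Implicit.
Unset Printing Implicit Defensive.

Import Order.TTheory GRing.Theory Num.Theory.

Local Open Scope ring_scope.

Section EnergySharing.

Variables (R : realType) (N : nat).
Variables (a : R) (c d D : 'rV[R]_N).

Implicit Types (i j : 'I_N) (p b : 'rV[R]_N) (pi bi : R).

Definition disutility i pi : R := c 0 i * pi ^+ 2 + d 0 i * pi.

Definition price b : R := - (1 / (N%:R * a)) * \sum_j b 0 j.

Definition quantity i b : R := a * price b + b 0 i.

(* The opponents' bids b_{-i} are passed as a full vector b, whose i-th entry
   is always overwritten by the bid bi of prosumer i before being read. *)
Definition with_bid i bi b : 'rV[R]_N :=
  \row_j (if j == i then bi else b 0 j).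

Definition cost i pi bi b : R :=
  disutility i pi
  + quantity i (with_bid i bi b) * price (with_bid i bi b).

Definition action_set i b (x : R * R) : Prop :=
  x.1 + quantity i (with_bid i x.2 b) = D 0 i.

(* A profile is the pair s = (p, b). *)
Definition nash_equilibrium (s : 'rV[R]_N * 'rV[R]_N) : Prop :=
  forall i,
    action_set i s.2 (s.1 0 i, s.2 0 i) /\
    forall pi bi, action_set i s.2 (pi, bi) ->
      cost i (s.1 0 i) (s.2 0 i) s.2 <= cost i pi bi s.2.

Definition objective p : R :=
  \sum_i ((c 0 i - 1 / (2 * (N%:R - 1) * a)) * p 0 i ^+ 2
          + (d 0 i + D 0 i / ((N%:R - 1) * a)) * p 0 i).

Definition feasible p : Prop := \sum_i p 0 i = \sum_i D 0 i.

Definition optimal_solution p : Prop :=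
  feasible p /\ forall p', feasible p' -> objective p <= objective p'.

Definition tilde_price p : R := 1 / N%:R * \sum_j (2 * c 0 j * p 0 j + d 0 j).

Definition tilde_bid p i : R := D 0 i - p 0 i - a * tilde_price p.

End EnergySharing.

(* Main.v *)
Require Import Defs.
From mathcomp Require Import all_boot all_order all_algebra.
From mathcomp Require Import reals.
From mathcomp Require Import ring lra.

(** The proof identifies the first-order conditions of two convex problems.

    Given the bids of the others, the clearing constraint makes the output of
    prosumer [i] an affine bijective function of its bid, so a unilateral
    deviation is described by the change [h] of its output alone. The price
    then moves by [h / ((N - 1) a)], and the cost of [i] changes by
    [A h ^ 2 + (m - price) h], where [A > 0] and [m] is
      [2 c_i p_i + d_i + (D_i - p_i) / ((N - 1) a)].
    Hence a profile is an equilibrium iff it is balanced and [m] equals the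
    price for every prosumer ([nash_equilibriumP]).

    The number [m] is also the [i]-th partial derivative of the objective of
    the optimization problem, whose solution is the feasible point at which all
    these derivatives are equal, by strict convexity ([optimal_solutionP]).
    The common value, the Lagrange multiplier, is the equilibrium price: at a
    feasible [p] the terms [D_i - p_i] sum to zero, so averaging [m] over [i]
    gives [tilde_price p], while the balance of the market recovers the bids
    from the outputs and the price. So [p |-> (p, tilde_bid p)] maps the
    optimal solutions onto the equilibria ([nash_optimalP]), and existence and
    uniqueness are those of the minimizer of a strictly convex quadratic on a
    hyperplane. *)

Set Implicit Arguments.
Unset Strict Implicit.
Unset Printing Implicit Defensive.

Import Order.TTheory GRing.Theory Num.Theory.

Local Open Scope ring_scope.

(** The minimum over [h] is attained at [- B / (2 A)], with the value
    [- B ^ 2 / (4 A)]. *)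
Lemma quadratic_ge0P (R : realFieldType) (A B : R) : 0 < A ->
  (forall h, 0 <= A * h ^+ 2 + B * h) <-> B = 0.
Proof.
move=> A_gt0; split=> [ge0 | -> h]; last first.
  by rewrite mul0r addr0 mulr_ge0 ?sqr_ge0 // ltW.
have A_neq0 : A != 0 by rewrite gt_eqF.
have := ge0 (- B / (2 * A)).
have -> : A * (- B / (2 * A)) ^+ 2 + B * (- B / (2 * A)) = - (B ^+ 2 / (4 * A)).
  by field.
rewrite oppr_ge0 pmulr_lle0 ?invr_gt0 ?mulr_gt0 // => B2_le0.
by apply/eqP; rewrite -sqrf_eq0 eq_le B2_le0 sqr_ge0.
Qed.

(** * Separable quadratic programs on a hyperplane *)

Section SeparableProgram.

Variables (R : realFieldType) (N : nat) (A e : 'I_N -> R).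
Hypothesis A_gt0 : forall i, 0 < A i.

Implicit Types (p q : 'rV[R]_N) (mu : R).

Definition separable_cost p : R :=
  \sum_i (A i * p 0 i ^+ 2 + e i * p 0 i).

Definition stationary mu p : Prop := forall i, 2 * A i * p 0 i + e i = mu.

(** The linear part of the expansion at [p] is [mu] times the sum of the
    increments, which vanishes along the hyperplane. *)
Lemma stationary_separable_cost mu p q :
  stationary mu p -> \sum_i q 0 i = \sum_i p 0 i ->
  separable_cost q = separable_cost p + \sum_i A i * (q 0 i - p 0 i) ^+ 2.
Proof.
move=> stat_p eq_sum.
have lin0 : \sum_i mu * (q 0 i - p 0 i) = 0.
  by rewrite -mulr_sumr sumrB eq_sum subrr mulr0.
rewrite -[RHS]addr0 -[X in _ = _ + X]lin0 /separable_cost -!big_split /=.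
by apply: eq_bigr => i _; rewrite -(stat_p i); ring.
Qed.

Lemma stationary_unique_min mu p q :
  stationary mu p -> \sum_i q 0 i = \sum_i p 0 i ->
  separable_cost q <= separable_cost p -> q = p.
Proof.
move=> stat_p eq_sum; rewrite (stationary_separable_cost stat_p eq_sum).
have ge0 i : true -> 0 <= A i * (q 0 i - p 0 i) ^+ 2.
  by rewrite mulr_ge0 ?sqr_ge0 // ltW.
rewrite gerDl => le0; apply/rowP => i; apply/eqP.
have /eqP : \sum_i A i * (q 0 i - p 0 i) ^+ 2 = 0.
  by apply/eqP; rewrite eq_le le0 sumr_ge0.
rewrite psumr_eq0 // => /allP /(_ i (mem_index_enum i)) /=.
by rewrite mulf_eq0 gt_eqF //= sqrf_eq0 subr_eq0.
Qed.

(** Stationarity gives [p i = (mu - e i) / (2 A i)], so the total is affine in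
    [mu] with the positive slope [\sum_i 1 / (2 A i)]: every total is reached
    by some multiplier. *)
Lemma stationary_exists (M : R) : (0 < N)%N ->
  exists mu p, stationary mu p /\ \sum_i p 0 i = M.
Proof.
move=> N_gt0.
pose w i := (2 * A i)^-1; pose W := \sum_i w i.
have w_gt0 i : 0 < w i by rewrite invr_gt0 mulr_gt0.
have W_neq0 : W != 0.
  rewrite gt_eqF // /W (bigD1 (Ordinal N_gt0)) //=.
  by rewrite ltr_pwDl // sumr_ge0 // => i _; rewrite ltW.
pose mu := (M + \sum_i e i * w i) / W.
exists mu, (\row_i ((mu - e i) * w i)); split=> [i|].
  by rewrite mxE /w; field; rewrite gt_eqF.
under eq_bigr do rewrite mxE mulrBl.
by rewrite sumrB -mulr_sumr -/W /mu divfK // addrK.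
Qed.

(** Necessity of stationarity needs no variation argument: a stationary
    feasible point exists and is the only minimizer. *)
Lemma separable_minP (M : R) p : (0 < N)%N ->
  (\sum_i p 0 i = M /\
   forall q, \sum_i q 0 i = M -> separable_cost p <= separable_cost q) <->
  (\sum_i p 0 i = M /\ exists mu, stationary mu p).
Proof.
move=> N_gt0; split=> -[sum_p].
  move=> min_p; split=> //.
  have [mu [q [stat_q sum_q]]] := stationary_exists M N_gt0.
  exists mu; rewrite (stationary_unique_min stat_q _ (min_p q sum_q)) //.
  by rewrite sum_p.
move=> [mu stat_p]; split=> // q sum_q.
rewrite (@stationary_separable_cost mu p q) // ?sum_p //.
by rewrite lerDl sumr_ge0 // => i _; rewrite mulr_ge0 ?sqr_ge0 // ltW.
Qed.

End SeparableProgram.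

(** * Unilateral deviations and equilibria *)

Section Game.

Variables (R : realType) (N : nat) (a : R) (c d D : 'rV[R]_N).
Hypotheses (N_ge2 : (2 <= N)%N) (a_lt0 : a < 0).
Hypothesis c_gt0 : forall i, 0 < c 0 i.

Implicit Types (i : 'I_N) (p b : 'rV[R]_N).

(** The [i]-th partial derivative of [objective], when prosumer [i] outputs
    [x]. *)
Definition marginal i (x : R) : R :=
  2 * c 0 i * x + d 0 i + (D 0 i - x) / ((N%:R - 1) * a).

Let N_gt1 : 1 < N%:R :> R. Proof. by rewrite ltr1n. Qed.
Let N_neq0 : N%:R != 0 :> R. Proof. by rewrite gt_eqF // (lt_trans ltr01). Qed.
Let N1_neq0 : N%:R - 1 != 0 :> R. Proof. by rewrite subr_eq0 gt_eqF. Qed.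
Let a_neq0 : a != 0. Proof. by rewrite lt_eqF. Qed.
Let N1a_lt0 : (N%:R - 1) * a < 0.
Proof. by rewrite pmulr_rlt0 // subr_gt0. Qed.

Lemma with_bid_id i b : with_bid i (b 0 i) b = b.
Proof. by apply/rowP => j; rewrite mxE; case: eqP => [->|]. Qed.

Lemma price_with_bid i x b :
  price a (with_bid i x b) = price a b - (x - b 0 i) / (N%:R * a).
Proof.
have -> : price a b - (x - b 0 i) / (N%:R * a)
          = - (1 / (N%:R * a)) * (\sum_j b 0 j + (x - b 0 i)).
  by rewrite /price; ring.
congr (_ * _); rewrite (bigD1 i) //= [in RHS](bigD1 i) //= mxE eqxx.
rewrite (eq_bigr (fun j => b 0 j)); first by ring.
by move=> j /negPf ne_ji; rewrite mxE ne_ji.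
Qed.

Lemma quantity_with_bid i x b :
  quantity a i (with_bid i x b)
  = quantity a i b + (N%:R - 1) / N%:R * (x - b 0 i).
Proof.
rewrite /quantity price_with_bid mxE eqxx.
by field; rewrite N_neq0 a_neq0.
Qed.

(** A change [h] of output forces the bid to change by [- N h / (N - 1)],
    because a fraction [1 / N] of a bid is lost to its effect on the price. *)
Lemma action_setP i b y (h x : R) :
  y + quantity a i b = D 0 i ->
  action_set a D i b (y + h, x) <-> x = b 0 i - N%:R / (N%:R - 1) * h.
Proof.
move=> bal; rewrite /action_set /= quantity_with_bid -bal.
split=> [eq_q | ->]; last by field; rewrite N_neq0 N1_neq0.
have -> : h = - ((N%:R - 1) / N%:R * (x - b 0 i)) by lra.
by field; rewrite N_neq0 N1_neq0.
Qed.

(** Producing [h] more means buying [h] less, at a price that has moved by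
    [h / ((N - 1) a)]. The product of the two changes is the quadratic term
    added to [c i]; the current quantity [D i - y] times the price change is
    the last term of [marginal]. *)
Lemma cost_deviation i b y (h : R) :
  y + quantity a i b = D 0 i ->
  cost a c d i (y + h) (b 0 i - N%:R / (N%:R - 1) * h) b
  = cost a c d i y (b 0 i) b
    + ((c 0 i - ((N%:R - 1) * a)^-1) * h ^+ 2
       + (marginal i y - price a b) * h).
Proof.
move=> bal; rewrite /cost with_bid_id quantity_with_bid price_with_bid.
rewrite /marginal -bal /disutility.
by field; rewrite N_neq0 N1_neq0 a_neq0.
Qed.

Lemma nash_equilibriumP p b :
  nash_equilibrium a c d D (p, b) <->
  forall i, p 0 i + quantity a i b = D 0 i /\ marginal i (p 0 i) = price a b.
Proof.
have curv_gt0 i : 0 < c 0 i - ((N%:R - 1) * a)^-1.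
  by rewrite subr_gt0 (lt_trans _ (c_gt0 i)) // invr_lt0.
split=> eqm i; have := eqm i; rewrite {1}/action_set /= with_bid_id.
  move=> [bal opt]; split=> //; apply/eqP; rewrite -subr_eq0; apply/eqP.
  apply/(quadratic_ge0P _ (curv_gt0 i)) => h.
  have := opt _ _ ((action_setP h _ bal).2 erefl).
  by rewrite cost_deviation // lerDl.
move=> [bal marg]; split=> // y x.
rewrite -[y](subrKC (p 0 i)) => /(action_setP _ _ bal) ->.
rewrite cost_deviation // lerDl.
by apply: (quadratic_ge0P _ (curv_gt0 i)).2; rewrite marg subrr.
Qed.

(** * The equivalent optimization problem *)

Definition curvature i : R := c 0 i - 1 / (2 * (N%:R - 1) * a).

Definition linear_coef i : R := d 0 i + D 0 i / ((N%:R - 1) * a).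

Lemma curvature_gt0 i : 0 < curvature i.
Proof.
rewrite subr_gt0 (lt_trans _ (c_gt0 i)) //.
by rewrite mul1r invr_lt0 -mulrA pmulr_rlt0.
Qed.

Lemma marginalE i (x : R) : marginal i x = 2 * curvature i * x + linear_coef i.
Proof.
by rewrite /marginal /curvature /linear_coef; field; rewrite N1_neq0 a_neq0.
Qed.

(** By conversion, [objective] is [separable_cost] with these coefficients, and
    [marginalE] makes its stationary points those with equal marginals. *)
Lemma optimal_solutionP p :
  optimal_solution a c d D p <->
  feasible D p /\ exists mu, forall i, marginal i (p 0 i) = mu.
Proof.
have minP := separable_minP linear_coef curvature_gt0.
apply: iff_trans (minP (\sum_i D 0 i) p (ltnW N_ge2)) _.
split=> -[feas [mu stat_p]].
  by split=> //; exists mu => i; rewrite marginalE.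
by split=> //; exists mu => i; rewrite -marginalE.
Qed.

Lemma optimal_solution_exists_unique :
  exists! p, optimal_solution a c d D p.
Proof.
have [mu [p [stat_p sum_p]]] :=
  stationary_exists linear_coef curvature_gt0 (\sum_i D 0 i) (ltnW N_ge2).
exists p; split=> [|q [sum_q min_q]].
  apply/optimal_solutionP; split; first exact: sum_p.
  by exists mu => i; rewrite marginalE.
apply/esym/(stationary_unique_min curvature_gt0 stat_p); first by rewrite sum_p.
exact: min_q.
Qed.

Lemma sum_quantity b : \sum_i quantity a i b = 0.
Proof.
rewrite /quantity big_split /= sumr_const card_ord /price -mulr_natr.
by field; rewrite N_neq0 a_neq0.
Qed.

Lemma mean_marginal p : feasible D p ->
  1 / N%:R * \sum_i marginal i (p 0 i) = tilde_price c d p.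
Proof.
move=> feas; rewrite /tilde_price /marginal big_split /=.
by rewrite -mulr_suml sumrB feas subrr mul0r addr0.
Qed.

Lemma marginal_tilde_price p mu : feasible D p ->
  (forall i, marginal i (p 0 i) = mu) -> mu = tilde_price c d p.
Proof.
move=> feas stat_p; rewrite -mean_marginal // (eq_bigr (fun=> mu)) //.
by rewrite sumr_const card_ord -mulr_natr; field.
Qed.

Lemma price_tilde_bid p b : feasible D p ->
  (forall i, b 0 i = tilde_bid a c d D p i) -> price a b = tilde_price c d p.
Proof.
move=> feas bid_b; rewrite /price (eq_bigr _ (fun i _ => bid_b i)) /tilde_bid.
rewrite sumrB sumrB feas subrr sumr_const card_ord -mulr_natr.
by field; rewrite N_neq0 a_neq0.
Qed.

Lemma nash_optimalP p b :
  nash_equilibrium a c d D (p, b) <->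
  optimal_solution a c d D p /\ forall i, b 0 i = tilde_bid a c d D p i.
Proof.
rewrite nash_equilibriumP optimal_solutionP; split.
  move=> eqm.
  have feas : feasible D p.
    rewrite /feasible -(eq_bigr _ (fun i _ => (eqm i).1)).
    by rewrite big_split /= sum_quantity addr0.
  have marg i : marginal i (p 0 i) = price a b by case: (eqm i).
  split=> [|i]; first by split=> //; exists (price a b).
  rewrite /tilde_bid -(marginal_tilde_price feas marg) -(eqm i).1.
  by rewrite /quantity; ring.
move=> [[feas [mu marg]] bid_b] i.
have price_b := price_tilde_bid feas bid_b.
split; last by rewrite price_b marg; exact: marginal_tilde_price.
by rewrite /quantity price_b bid_b /tilde_bid; ring.
Qed.

End Game.

Theorem proposition1 (R : realType) (N : nat) (a : R) (c d D : 'rV[R]_N)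
    (hN : (2 <= N)%N) (ha : a < 0)
    (hc : forall i : 'I_N, 0 < c 0 i) (hd : forall i : 'I_N, 0 < d 0 i) :
  (exists! s : 'rV[R]_N * 'rV[R]_N, nash_equilibrium a c d D s) /\
  (forall p b : 'rV[R]_N,
      unique (nash_equilibrium a c d D) (p, b) <->
      unique (optimal_solution a c d D) p /\
      (forall i : 'I_N, b 0 i = tilde_bid a c d D p i)).
Proof.
have nashP := nash_optimalP d D hN ha hc.
have [p0 [opt_p0 uniq_p0]] := optimal_solution_exists_unique d D hN ha hc.
have nash_uniq s s' :
    nash_equilibrium a c d D s -> nash_equilibrium a c d D s' -> s = s'.
  case: s s' => [p b] [p' b'] /nashP [opt_p bid_b] /nashP [opt_p' bid_b'].
  have eq_p : p = p' by rewrite -(uniq_p0 p) // -(uniq_p0 p').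
  congr pair; first exact: eq_p.
  by apply/rowP => i; rewrite bid_b bid_b' eq_p.
split=> [|p b].
  exists (p0, \row_i tilde_bid a c d D p0 i).
  have eqm : nash_equilibrium a c d D (p0, \row_i tilde_bid a c d D p0 i).
    by apply/nashP; split=> // i; rewrite mxE.
  by split=> // s; exact: nash_uniq.
split=> [[/nashP [opt_p bid_b] _] | [[opt_p _] bid_b]].
  by split=> //; split=> // q opt_q; rewrite -(uniq_p0 p) // -(uniq_p0 q).
have eqm : nash_equilibrium a c d D (p, b) by apply/nashP.
by split=> // s; exact: nash_uniq.
Qed.
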